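(* (Lagrange's formula) Let $\mathbb{F}$ be a field of characteristic not $2$ and let $B$ be an invertible symmetric $3\times 3$ matrix over $\mathbb{F}$. For all vectors $v_1,v_2,v_3\in\mathbb{V}^3=\mathbb{F}^3$, $$\left\langle v_1,v_2,v_3\right\rangle_B=(\det B)\left[(v_1\cdot_B v_3)\,v_2-(v_1\cdot_B v_2)\,v_3\right].$$
   Context: $\mathbb{V}^3$ is the space of row vectors $(x,y,z)$ over $\mathbb{F}$. The $B$-scalar product is $v\cdot_B w=vBw^T$. The Euclidean vector product is $(x_1,y_1,z_1)\times(x_2,y_2,z_2)=(y_1z_2-y_2z_1,\;x_2z_1-x_1z_2,\;x_1y_2-x_2y_1)$. The $B$-vector product is $v\times_B w=(v\times w)\,\mathrm{adj}\,B$ (row vector times matrix), where $\mathrm{adj}\,B=(\det B)B^{-1}$ is the adjugate of $B$. The $B$-vector triple product is $\langle v_1,v_2,v_3\rangle_B=v_1\times_B(v_2\times_B v_3)$. *)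

(* Defs.v *)
From mathcomp Require Import all_boot all_order all_algebra.

Set Implicit Arguments.
Unset Strict Implicit.
Unset Printing Implicit Defensive.

Import GRing.Theory.
Local Open Scope ring_scope.

Definition row3 (F : fieldType) (x y z : F) : 'rV[F]_3 :=
  \row_(j < 3) nth 0 [:: x; y; z] j.

(* The entry of the 1 x 1 matrix v B w^T. *)
Definition bdot (F : fieldType) (B : 'M[F]_3) (v w : 'rV[F]_3) : F :=
  (v *m B *m w^T) 0 0.

(* In [v 0 j] the first index is the only row; j = 0, 1, 2 : 'I_3 selects
   the coordinates x, y, z. *)
Definition cross (F : fieldType) (v w : 'rV[F]_3) : 'rV[F]_3 :=
  row3 (v 0 1 * w 0 2 - w 0 1 * v 0 2)
       (w 0 0 * v 0 2 - v 0 0 * w 0 2)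
       (v 0 0 * w 0 1 - w 0 0 * v 0 1).

Definition bcross (F : fieldType) (B : 'M[F]_3) (v w : 'rV[F]_3) : 'rV[F]_3 :=
  cross v w *m \adj B.

Definition btriple (F : fieldType) (B : 'M[F]_3) (v1 v2 v3 : 'rV[F]_3) :
    'rV[F]_3 :=
  bcross B v1 (bcross B v2 v3).

(* Main.v *)
Require Import Defs.
From mathcomp Require Import all_boot all_order all_algebra.
From mathcomp Require Import ring.

Import GRing.Theory.
Local Open Scope ring_scope.

(** The Euclidean formula [x * (y * z) = (x . z) y - (x . y) z] is a polynomial
    identity in coordinates.  The general case reduces to it through the
    behaviour of the Euclidean product under a linear map: [(v M) * (w M)] is
    [v * w] transformed by the cofactor matrix [(\adj M)^T]
    ([cross_mulmx]).  For symmetric [B] this matrix is [\adj B] itself, so with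
    [u := v2 * v3] the outer adjugate of the triple product can be absorbed:
    [(v1 * (u \adj B)) \adj B = (v1 B) * (u \adj B B) = \det B ((v1 B) * u)].
    The Euclidean formula ([cross_cross]) with [v1 B] as its first factor then
    gives the claim, since the Euclidean scalar product of [v1 B] with [w] is
    [bdot B v1 w]. *)

Lemma sum_ord3 (V : nmodType) (f : 'I_3 -> V) :
  \sum_i f i = f 0 + f 1 + f 2.
Proof.
rewrite 3!big_ord_recr big_ord0 /= add0r.
by congr (f _ + f _ + f _); exact: val_inj.
Qed.

Lemma eq_row3 (F : fieldType) (v w : 'rV[F]_3) :
  v 0 0 = w 0 0 -> v 0 1 = w 0 1 -> v 0 2 = w 0 2 -> v = w.
Proof.
move=> e0 e1 e2; apply/rowP => -[[|[|[|//]]] ltj3].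
- by rewrite (_ : Ordinal ltj3 = 0) //; exact: val_inj.
- by rewrite (_ : Ordinal ltj3 = 1) //; exact: val_inj.
- by rewrite (_ : Ordinal ltj3 = 2) //; exact: val_inj.
Qed.

Lemma crossZr (F : fieldType) (c : F) (v w : 'rV[F]_3) :
  cross v (c *: w) = c *: cross v w.
Proof. by apply: eq_row3; rewrite !mxE /=; ring. Qed.

(** Cofactors of a 3 x 3 matrix as 2 x 2 minors. Indexing the entries by natural
    numbers lets the ordinals produced by deleting a row and a column compute. *)
Lemma cofactor3E (F : fieldType) (M : 'M[F]_3) (i j : 'I_3) :
  let m a b := M (inord a) (inord b) in
  cofactor M i j = (-1) ^+ (i + j) *
    (m (bump i 0) (bump j 0) * m (bump i 1) (bump j 1) -
     m (bump i 0) (bump j 1) * m (bump i 1) (bump j 0)).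
Proof.
move=> m; have mE k l : M k l = m k l by rewrite /m !inord_val.
rewrite /cofactor (expand_det_row _ ord0) !big_ord_recr big_ord0 /= add0r.
rewrite /cofactor !det_mx11 !mxE !mE /= /bump /=.
by ring.
Qed.

(** The coordinates of [cross (v *m M) (w *m M)] are, up to sign, the 2 x 2 minors of a
    product of a 2 x 3 and a 3 x 3 matrix, and the identity is the Cauchy-Binet
    formula for them. *)
Lemma cross_mulmx (F : fieldType) (M : 'M[F]_3) (v w : 'rV[F]_3) :
  cross (v *m M) (w *m M) = cross v w *m (\adj M)^T.
Proof.
have i0 : inord 0 = 0 :> 'I_3 by apply: val_inj; rewrite /= inordK.
have i1 : inord 1 = 1 :> 'I_3 by apply: val_inj; rewrite /= inordK.
have i2 : inord 2 = 2 :> 'I_3 by apply: val_inj; rewrite /= inordK.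
apply: eq_row3; rewrite !mxE /= !sum_ord3 !mxE /= !cofactor3E /bump /=;
  rewrite ?addn0 ?add0n ?i0 ?i1 ?i2; by ring.
Qed.

(** Lagrange's formula for the identity form. *)
Lemma cross_cross (F : fieldType) (x y z : 'rV[F]_3) :
  cross x (cross y z) = (x *m z^T) 0 0 *: y - (x *m y^T) 0 0 *: z.
Proof. by apply: eq_row3; rewrite !mxE /= !sum_ord3 !mxE /=; ring. Qed.

Theorem theorem5 (F : fieldType) (hF : 2%N \notin [pchar F])
    (B : 'M[F]_3) (hBsym : B^T = B) (hBinv : B \in unitmx)
    (v1 v2 v3 : 'rV[F]_3) :
  btriple B v1 v2 v3 =
    \det B *: (bdot B v1 v3 *: v2 - bdot B v1 v2 *: v3).
Proof.
have adj_sym : (\adj B)^T = \adj B by rewrite trmx_adj hBsym.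
rewrite /btriple /bcross; set u := cross v2 v3.
rewrite -[in LHS]adj_sym -cross_mulmx adj_sym.
by rewrite -mulmxA mul_adj_mx mul_mx_scalar crossZr cross_cross.
Qed.
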